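(* Let $\rho\in(0,1)$. All non-zero eigenvalues of the operator $\mathcal K^{(\rho)}$ on $L^2(0,1)$, $(\mathcal K^{(\rho)}f)(x)=\int_0^1 |x-y|^{-\rho}f(y)\,\mathrm dy$, are simple, and the associated eigenfunctions are continuous in $[0,1]$.
   Context: The operator $\mathcal K^{(\rho)}$ is a compact, self-adjoint, positive semi-definite operator on $L^2(0,1)$. A non-zero eigenvalue $\lambda$ is called simple if $\dim\ker(\lambda I-\mathcal K^{(\rho)})=1$. Continuity of an eigenfunction (an element of $L^2(0,1)$) means that it has a representative continuous on $[0,1]$. *)

(* Defs.v *)
From HB Require Import structures.
From mathcomp Require Import all_boot all_order all_algebra.
From mathcomp Require Import all_classical all_reals all_analysis.
Import Order.TTheory GRing.Theory Num.Theory.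
Import numFieldNormedType.Exports.

Set Implicit Arguments.
Unset Strict Implicit.
Unset Printing Implicit Defensive.

Local Open Scope classical_set_scope.
Local Open Scope ring_scope.

(* Lebesgue measure on (0,1), as a measure on R that ignores the complement
   of (0,1); "%[ae lebesgue01 R]" is thus equality almost everywhere on (0,1),
   i.e. equality in L^2(0,1). *)
Definition lebesgue01 (R : realType) : {measure set (measurableTypeR R) -> \bar R} :=
  mrestr (@lebesgue_measure R) (measurable_itv `]0%R, 1%R[).

(* Real-valued L^2(0,1). The elements are classes of functions modulo
   a.e. equality; applying f : L2_01 R to a point evaluates its canonical
   representative. The library gives this quotient no module structure, so
   linear combinations are written with representatives, up to a.e. equality. *)
Definition L2_01 (R : realType) := LspaceType2 (lebesgue01 R).

(* The value does not depend on the representative of f. For f in L^2(0,1) and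
   0 < rho < 1 the integral converges for a.e. x. The kernel at y = x is
   0 `^ (- rho) = 0, which is immaterial since {x} is negligible. *)
Definition Kop (R : realType) (rho : R) (f : R -> R) (x : R) : R :=
  \int[lebesgue_measure]_(y in `]0%R, 1%R[) (`|x - y| `^ (- rho) * f y).

Definition ker_sub_Kop (R : realType) (rho lambda : R) : set (L2_01 R) :=
  [set f | (fun x => lambda * f x - Kop rho f x) = (fun=> 0)
           %[ae lebesgue01 R]].

Definition Kop_eigenfunction (R : realType) (rho lambda : R) (f : L2_01 R) : Prop :=
  ker_sub_Kop rho lambda f /\ ~ ((f : R -> R) = (fun=> 0) %[ae lebesgue01 R]).

Definition Kop_eigenvalue (R : realType) (rho lambda : R) : Prop :=
  exists f : L2_01 R, Kop_eigenfunction rho lambda f.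

(* V is a linear subspace of L^2(0,1) of dimension n, with basis e. *)
Definition has_dim (R : realType) (V : set (L2_01 R)) (n : nat) : Prop :=
  exists e : 'I_n -> L2_01 R,
    (forall c : 'I_n -> R,
       (fun x => \sum_(i < n) c i * e i x) = (fun=> 0) %[ae lebesgue01 R] ->
       forall i, c i = 0) /\
    (forall f : L2_01 R, V f <->
       exists c : 'I_n -> R,
         (f : R -> R) = (fun x => \sum_(i < n) c i * e i x)
         %[ae lebesgue01 R]).

Definition Kop_simple (R : realType) (rho lambda : R) : Prop :=
  has_dim (ker_sub_Kop rho lambda) 1.

Definition continuous_on01 (R : realType) (f : L2_01 R) : Prop :=
  exists g : R -> R, {within `[0%R, 1%R], continuous g} /\
    (f : R -> R) = g %[ae lebesgue01 R].

(* Main.v *)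
Require Import Defs.
From mathcomp Require Import all_boot all_order all_algebra.
From mathcomp Require Import ring lra.
From mathcomp Require Import all_classical all_reals all_analysis.
From mathcomp Require Import measurable_realfun.
Import Order.TTheory GRing.Theory Num.Theory.
Import numFieldNormedType.Exports.
Set Implicit Arguments.
Unset Strict Implicit.
Unset Printing Implicit Defensive.
Local Open Scope classical_set_scope.
Local Open Scope ring_scope.

(** Write K for the operator with kernel |x - y|^(-r) on (0,1).

    Regularity.  The kernel is a bounded continuous function of x - y (the far
    part) plus a nonnegative remainder (the near part) whose integral over the
    line is as small as one likes.  If la f = K f with la <> 0 and f only
    integrable, the far part contributes a bounded function, and the near part
    is a contraction: the excess w of |f| over a suitable constant satisfies
    |la| w <= N w a.e., where the integral of N w is at most |la|/2 times that
    of w, so w = 0 a.e. ([Kop_eigen_ae_bounded]).  On bounded functions K is a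
    uniform limit of the continuous functions given by the far parts
    ([continuous_Kop]), and therefore F := K f / la is a continuous function
    on the whole line, a.e. equal to f on (0,1), with la F = K F everywhere,
    also outside [0,1] ([Kop_eigen_continuous]).

    Simplicity.  The kernel is symmetric and homogeneous under dilations.
    Pairing F with its dilate F(s x) and moving K to the other side gives, after
    the change of variables y = s z,
      (1 - s^(1-r)) * int_0^1 F(s z) F(z) dz
        = s^(1-r) * int_1^(1/s) F(s z) F(z) dz          (0 < s <= 1)
    ([eigen_dilation_identity]).  Dividing by 1 - s and letting s tend to 1
    yields (1 - r) int_0^1 F^2 = F(1)^2.  An eigenfunction that vanishes at the
    endpoint 1 is thus zero, so evaluation at 1 is injective on the eigenspace,
    whose dimension is at most 1. *)

(** * The kernel and its splitting *)

Lemma ge0_integral_reflect (R : realType) (x : R) (f : R -> \bar R) :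
  measurable_fun setT f -> (forall t, (0 <= f t)%E) ->
  (\int[@lebesgue_measure R]_y f (x - y)%R = \int[@lebesgue_measure R]_t f t)%E.
Proof.
move=> mf f0.
pose g : measurableTypeR R -> measurableTypeR R := fun y => x - y.
have mg : measurable_fun setT g by exact: measurable_funB.
have muE A : measurable A -> pushforward (@lebesgue_measure R) g A = lebesgue_measure A.
  move=> mA; apply/esym/lebesgue_measure_unique => //= _ [[a b]] _ <-.
  rewrite /pushforward.
  have -> : g @^-1` `]a, b] = `[x - b, x - a[%classic.
    by apply/seteqP; split => y /=; rewrite /g !in_itv/= => /andP[? ?]; apply/andP; split; lra.
  rewrite !lebesgue_measure_itv/= !lte_fin ltrD2l ltrN2; case: ifP => // _.
  by rewrite -!EFinD; congr EFin; ring.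
transitivity (\int[pushforward (@lebesgue_measure R) g]_t f t)%E.
  by rewrite ge0_integral_pushforward.
by apply: eq_measure_integral => A mA _; exact: muE.
Qed.

(** The integrand is unbounded at 0, so the antiderivative is evaluated on
    [d / (n + 2), d] and the integral is the limit of these by monotone
    convergence. *)
Lemma ge0_integral_powR0 (R : realType) (r d : R) : r < 1 -> 0 < d ->
  (\int[@lebesgue_measure R]_(t in `]0%R, d]) (t `^ (- r))%:E
    <= (d `^ (1 - r) / (1 - r))%:E)%E.
Proof.
move=> r1 d0.
pose F (n : nat) := `[n.+2%:R^-1 * d, d]%classic.
have F_gt0 n : 0 < n.+2%:R^-1 * d by rewrite mulr_gt0// invr_gt0.
have UF : `]0%R, d]%classic = \bigcup_n F n.
  apply/seteqP; split => t /=; rewrite in_itv/=.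
  - move=> /andP[t0 td].
    have [n nP] := ltr_add_invr (y:=0) (x:=t/d) ltac:(by rewrite divr_gt0).
    exists n => //; rewrite /F/= in_itv/= td andbT.
    rewrite -ler_pdivlMr//; apply: le_trans (ltW nP).
    by rewrite add0r lef_pV2 ?posrE// ler_nat.
  - move=> [n _]; rewrite /F/= in_itv/= => /andP[h ->]; rewrite andbT.
    exact: lt_le_trans h.
have mpow : measurable_fun setT (fun t : R => (t `^ (- r))%:E).
  by apply/measurable_EFinP; exact: measurable_powR.
have cvgF : (\int[@lebesgue_measure R]_(t in F n) (t `^ (- r))%:E @[n --> \oo]
    --> \int[@lebesgue_measure R]_(t in `]0%R, d]) (t `^ (- r))%:E)%E.
  rewrite UF; apply: ge0_nondecreasing_set_cvg_integral.
  - move=> m n mn; apply/subsetPset => t; rewrite /F/= !in_itv/= => /andP[h ->].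
    rewrite andbT (le_trans _ h)// ler_pM2r// lef_pV2 ?posrE//.
    by rewrite ler_nat !ltnS.
  - by move=> n; exact: measurable_itv.
  - by move=> n; apply: measurable_funS mpow.
  - by move=> n t _; rewrite lee_fin powR_ge0.
rewrite -(cvg_lim _ cvgF)//; apply: lime_le; first by apply/cvg_ex; eexists; exact: cvgF.
near=> n.
have powD (t : R) : 0 < t -> is_derive t (1 : R) (fun u : R => u `^ (1 - r) / (1 - r)) (t `^ (- r)).
  move=> t0.
  have h1 := @is_derive1_powR R (1 - r) t t0.
  have := is_deriveM h1 (is_derive_cst ((1 - r)^-1 : R) t 1).
  move=> /is_derive_eq; apply.
  rewrite scaler0 add0r /GRing.scale/=.
  have -> : 1 - r - 1 = - r by ring.
  by rewrite mulrA mulVf ?mul1r// subr_eq0 gt_eqF.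
rewrite (@continuous_FTC2 _ _ (fun u : R => u `^ (1 - r) / (1 - r))).
- rewrite -EFinB lee_fin lerBlDr lerDl divr_ge0 ?powR_ge0//; lra.
- rewrite -[ltRHS]mul1r ltr_pM2r// invf_lt1 ?ltr0n// ltr1n//.
- apply: derivable_within_continuous => t; rewrite in_itv/= => /andP[h _].
  apply: derivable_powR; rewrite in_itv/= andbT; exact: lt_le_trans h.
- have cP (t : R) : 0 < t -> {for t, continuous (fun u : R => u `^ (1 - r) / (1 - r))}.
    move=> t0; have [+ _] := powD _ t0.
    by move=> /derivable1_diffP/differentiable_continuous.
  split.
  + move=> t; rewrite in_itv/= => /andP[h _].
    by have [] := powD t (lt_trans (F_gt0 n) h).
  + exact/cvg_at_right_filter/cP.
  + exact/cvg_at_left_filter/cP.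
- move=> t; rewrite in_itv/= => /andP[h _].
  have t0 := lt_trans (F_gt0 n) h.
  by rewrite derive1E; have [_ ->] := powD t t0.
Unshelve. all: end_near. Qed.

(** The splitting far + near of |t|^(-r) is chosen so that the far part is
    continuous also at t = 0, where it agrees with the value 0 `^ (- r) = 0,
    and the near part is nonnegative and vanishes for |t| >= d.  The identity
    between them then holds at every point, with no exceptional null set. *)
Definition near_kernel (R : realType) (r d t : R) : R :=
  `|t| `^ (- r) * Num.max 0 (1 - `|t| / d).

Definition far_kernel (R : realType) (r d t : R) : R :=
  `|t| `^ (1 - r) / Num.max `|t| d.

Lemma near_kernel_ge0 (R : realType) (r d t : R) : 0 <= near_kernel r d t.
Proof. by rewrite mulr_ge0 ?powR_ge0// le_max lexx. Qed.

Lemma far_kernel_ge0 (R : realType) (r d t : R) : 0 < d -> 0 <= far_kernel r d t.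
Proof. by move=> d0; rewrite divr_ge0 ?powR_ge0// le_max normr_ge0. Qed.

Lemma far_near_kernel (R : realType) (r d t : R) : 0 < r -> r < 1 -> 0 < d ->
  `|t| `^ (- r) = far_kernel r d t + near_kernel r d t.
Proof.
move=> r0 r1 d0; rewrite /far_kernel /near_kernel.
have [->|t0] := eqVneq t 0.
  rewrite normr0 !powR0 ?mul0r ?addr0//; last by rewrite oppr_eq0 gt_eqF.
  by rewrite subr_eq0 gt_eqF.
have n0 : 0 < `|t| by rewrite normr_gt0.
have -> : `|t| `^ (1 - r) = `|t| * `|t| `^ (- r).
  by rewrite powRD ?powRr1//; apply/implyP => _; rewrite gt_eqF.
have [h|h] := leP `|t| d.
- have -> : Num.max 0 (1 - `|t| / d) = 1 - `|t| / d.
    by apply/max_idPr; rewrite subr_ge0 ler_pdivrMr// mul1r.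
  by field; rewrite gt_eqF.
- have -> : Num.max 0 (1 - `|t| / d) = 0.
    by apply/max_idPl; rewrite subr_le0 ler_pdivlMr// mul1r ltW.
  by field; rewrite gt_eqF.
Qed.

Lemma far_kernel_le (R : realType) (r d t : R) : 0 < r -> r < 1 -> 0 < d ->
  far_kernel r d t <= d `^ (- r).
Proof.
move=> r0 r1 d0; rewrite /far_kernel ler_pdivrMr; last by rewrite lt_max d0 orbT.
have dE : d `^ (- r) * d = d `^ (1 - r).
  by rewrite powRD ?powRr1 ?ltW 1?mulrC//; apply/implyP => _; rewrite gt_eqF.
have [h|h] := leP `|t| d.
  by rewrite dE ge0_ler_powR// ?nnegrE ?subr_ge0 ?ltW.
have t0 : 0 < `|t| by exact: lt_trans h.
have -> : `|t| `^ (1 - r) = `|t| `^ (- r) * `|t|.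
  by rewrite powRD ?powRr1// 1?mulrC//; apply/implyP => _; rewrite gt_eqF.
rewrite ler_pM2r// !powRN lef_pV2 ?posrE ?powR_gt0//.
by rewrite ge0_ler_powR// ?nnegrE ltW.
Qed.

Lemma continuous_norm_powR (R : realType) (a : R) : 0 < a ->
  continuous (fun t : R => `|t| `^ a).
Proof.
move=> a0 t.
have [->|t0] := eqVneq t 0.
  rewrite /continuous_at normr0 powR0 ?gt_eqF//.
  apply/cvgr0Pnorm_lt => e e0.
  have ea0 : 0 < e `^ a^-1 by rewrite powR_gt0.
  near=> u.
  rewrite ger0_norm ?powR_ge0//.
  have -> : e = (e `^ a^-1) `^ a.
    by rewrite -powRrM mulVf ?gt_eqF// powRr1// ltW.
  by apply: gt0_ltr_powR => //; rewrite ?nnegrE ?(ltW ea0)//.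
have cN : {for t, continuous (fun u : R => `|u|)} by exact: norm_continuous.
have cP : {for `|t|, continuous (fun u : R => u `^ a)}.
  have : derivable (fun u : R => u `^ a) `|t| 1.
    by apply: derivable_powR; rewrite in_itv/= andbT normr_gt0.
  by move=> /derivable1_diffP/differentiable_continuous.
exact: (continuous_comp cN cP).
Unshelve. all: end_near. Qed.

Lemma continuous_far_kernel (R : realType) (r d : R) : r < 1 -> 0 < d ->
  continuous (far_kernel r d).
Proof.
move=> r1 d0 t; apply: (@continuousM _ _ (fun t : R => `|t| `^ (1 - r))).
  by apply: continuous_norm_powR; rewrite subr_gt0.
apply: continuousV; first by rewrite gt_eqF// lt_max d0 orbT.
by apply: continuous_max; [exact: norm_continuous|exact: cst_continuous].
Qed.

Lemma measurable_norm_powR (R : realType) (a : R) :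
  measurable_fun setT (fun t : R => `|t| `^ a).
Proof.
have mN : measurable_fun setT (@Num.norm R R) by exact: normr_measurable.
exact: (measurableT_comp (@measurable_powR R a) mN).
Qed.

Lemma measurable_near_kernel (R : realType) (r d : R) :
  measurable_fun setT (near_kernel r d).
Proof.
apply: measurable_funM; first exact: measurable_norm_powR.
apply: measurable_maxr => //; apply: measurable_funB => //.
by apply: measurable_funM => //; exact: normr_measurable.
Qed.

Definition near_mass (R : realType) (r d : R) : R := 2 * (d `^ (1 - r) / (1 - r)).

(** The near part is supported in |t| < d and bounded there by |t|^(-r), hence
    by the sum of t^(-r) on (0, d] and of its reflection. *)
Lemma integral_near_kernel (R : realType) (r d : R) : 0 < r -> r < 1 -> 0 < d ->
  (\int[@lebesgue_measure R]_t (near_kernel r d t)%:E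
   <= (near_mass r d)%:E)%E.
Proof.
move=> r0 r1 d0.
pose h (t : R) := ((fun t => (t `^ (- r))%:E) \_ `]0%R, d]) t.
have mh : measurable_fun setT h.
  apply/(measurable_restrictT _ _).1 => //; apply: measurable_funTS.
  by apply/measurable_EFinP; exact: measurable_powR.
have h0 t : (0 <= h t)%E.
  by apply: erestrict_ge0 => u _; rewrite lee_fin powR_ge0.
have le_h t : ((near_kernel r d t)%:E <= h t + h (0 - t)%R)%E.
  have [lt_d|le_d] := ltP `|t| d; last first.
    rewrite /near_kernel (_ : Num.max _ _ = 0) ?mulr0 ?adde_ge0//.
    by apply/max_idPl; rewrite subr_le0 ler_pdivlMr// mul1r.
  have nle : near_kernel r d t <= `|t| `^ (- r).
    rewrite /near_kernel ler_piMr ?powR_ge0// ge_max ler01/=.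
    by rewrite lerBlDr lerDl divr_ge0// ltW.
  have [t0|t0|->] := ltgtP t 0.
  - rewrite -[leLHS]add0e leeD// /h patchE mem_set ?lee_fin.
      by rewrite sub0r -ltr0_norm.
    by rewrite /= in_itv/= sub0r; rewrite ltr0_norm// in lt_d; apply/andP; split; lra.
  - rewrite -[leLHS]adde0 leeD// /h patchE mem_set ?lee_fin.
      by rewrite -{2}(gtr0_norm t0).
    by rewrite /= in_itv/=; rewrite gtr0_norm// in lt_d; apply/andP; split; lra.
  - rewrite /near_kernel normr0 powR0 ?mul0r ?adde_ge0//.
    by rewrite oppr_eq0 gt_eqF.
have Ih : (\int[@lebesgue_measure R]_t h t <= (d `^ (1 - r) / (1 - r))%:E)%E.
  by rewrite /h -integral_mkcond; exact: ge0_integral_powR0.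
have mhN : measurable_fun setT (fun t : R => h (0 - t)).
  by apply: (measurableT_comp mh); exact: measurable_funB.
apply: (@le_trans _ _ (\int[@lebesgue_measure R]_t (h t + h (0 - t)%R))%E).
  apply: ge0_le_integral => //.
  - by move=> t _; rewrite lee_fin near_kernel_ge0.
  - by apply/measurable_EFinP; exact: measurable_near_kernel.
  - exact: emeasurable_funD.
rewrite ge0_integralD// ge0_integral_reflect//.
by rewrite /near_mass mulr2n mulrDl !mul1r EFinD leeD.
Qed.

Lemma near_mass_ge0 (R : realType) (r d : R) : r < 1 -> 0 <= near_mass r d.
Proof.
by move=> r1; rewrite /near_mass mulr_ge0// divr_ge0 ?powR_ge0// subr_ge0 ltW.
Qed.

Lemma near_mass_small (R : realType) (r e : R) : r < 1 -> 0 < e ->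
  exists2 d, 0 < d & near_mass r d <= e.
Proof.
move=> r1 e0; have a0 : 0 < 1 - r by rewrite subr_gt0.
have x0 : 0 < e * (1 - r) / 2 by rewrite divr_gt0 ?mulr_gt0.
exists ((e * (1 - r) / 2) `^ (1 - r)^-1); first by rewrite powR_gt0.
rewrite /near_mass -powRrM mulVf ?gt_eqF// powRr1 ?(ltW x0)//.
by rewrite le_eqVlt; apply/orP; left; apply/eqP; field; rewrite gt_eqF.
Qed.

Lemma near_kernelN (R : realType) (r d t : R) :
  near_kernel r d (- t) = near_kernel r d t.
Proof. by rewrite /near_kernel normrN. Qed.

Lemma measurable_subr (R : realType) (g : R -> R) (x : R) :
  measurable_fun setT g -> measurable_fun setT (fun y : R => g (x - y)).
Proof. by move=> mg; apply: (measurableT_comp mg); exact: measurable_funB. Qed.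

Lemma measurable_subl (R : realType) (g : R -> R) (y : R) :
  measurable_fun setT g -> measurable_fun setT (fun x : R => g (x - y)).
Proof. by move=> mg; apply: (measurableT_comp mg); exact: measurable_funB. Qed.

Lemma measurable_far_kernel (R : realType) (r d : R) : r < 1 -> 0 < d ->
  measurable_fun setT (far_kernel r d).
Proof.
by move=> r1 d0; apply: continuous_measurable_fun; exact: continuous_far_kernel.
Qed.

Lemma integral_near_kernelr (R : realType) (r d x : R) : 0 < r -> r < 1 -> 0 < d ->
  (\int[@lebesgue_measure R]_y (near_kernel r d (x - y)%R)%:E <= (near_mass r d)%:E)%E.
Proof.
move=> r0 r1 d0; rewrite (ge0_integral_reflect x (f := EFin \o near_kernel r d)).
- exact: integral_near_kernel.
- by apply/measurable_EFinP; exact: measurable_near_kernel.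
- by move=> t; rewrite lee_fin near_kernel_ge0.
Qed.

Lemma integral_near_kernell (R : realType) (r d y : R) : 0 < r -> r < 1 -> 0 < d ->
  (\int[@lebesgue_measure R]_x (near_kernel r d (x - y)%R)%:E <= (near_mass r d)%:E)%E.
Proof.
move=> r0 r1 d0; under eq_integral => x _ do rewrite -near_kernelN opprB.
exact: integral_near_kernelr.
Qed.

Lemma measurable_near_smoothing (R : realType) (r d : R) (w : R -> R) :
  measurable_fun setT w ->
  measurable_fun setT (fun z : measurableTypeR R * measurableTypeR R =>
    (near_kernel r d (z.1 - z.2) * w z.2)%:E).
Proof.
move=> mw; apply/measurable_EFinP; apply: measurable_funM.
  apply: (measurableT_comp (measurable_near_kernel r d)).
  by apply: measurable_funB; [exact: measurable_fst|exact: measurable_snd].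
by apply: (measurableT_comp mw); exact: measurable_snd.
Qed.

(** Convolution with the near part is bounded on L^1 by the mass of the near
    part: integrate in the other order. *)
Lemma integral_near_smoothing (R : realType) (r d : R) (w : R -> R) :
  0 < r -> r < 1 -> 0 < d -> measurable_fun setT w -> (forall x, 0 <= w x) ->
  (\int[@lebesgue_measure R]_x \int[@lebesgue_measure R]_y
      (near_kernel r d (x - y)%R * w y)%:E <=
   (near_mass r d)%:E * \int[@lebesgue_measure R]_y (w y)%:E)%E.
Proof.
move=> r0 r1 d0 mw w0.
have mk := measurable_near_smoothing r d mw.
have k0 z : (0 <= ((near_kernel r d (z.1 - z.2) * w z.2)%R)%:E :> \bar R)%E.
  by rewrite lee_fin mulr_ge0 ?near_kernel_ge0.
rewrite (fubini_tonelli (fun z : measurableTypeR R * measurableTypeR R =>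
    (near_kernel r d (z.1 - z.2) * w z.2)%:E) mk k0)/=.
rewrite -ge0_integralZl//; last 3 first.
- by apply/measurable_EFinP.
- by move=> y _; rewrite lee_fin.
- by rewrite lee_fin near_mass_ge0.
apply: ge0_le_integral => //.
- by move=> y _; apply: integral_ge0 => x _; exact: (k0 (x, y)).
- exact: (measurable_fun_fubini_tonelli_G (fun z : measurableTypeR R * measurableTypeR R =>
    (near_kernel r d (z.1 - z.2) * w z.2)%:E) mk k0).
- apply: emeasurable_funM => //; exact/measurable_EFinP.
move=> y _; under eq_integral => x _ do rewrite EFinM.
rewrite ge0_integralZr//.
- by rewrite lee_wpmul2r ?lee_fin// integral_near_kernell.
- by apply/measurable_EFinP; apply: measurable_subl; exact: measurable_near_kernel.
- by move=> x _; rewrite lee_fin near_kernel_ge0.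
- by rewrite lee_fin.
Qed.

(** * Integrable eigenfunctions are essentially bounded *)

(** For r >= 1/2 the kernel is not square integrable, and the Cauchy-Schwarz
    inequality does not bound K f for f in L^2.  The bound comes instead from a
    maximum principle for the excess w of |f| over B: the near part has mass at
    most |la|/2, so both the constant B and w are contracted by it. *)
Lemma Kop_eigen_ae_bounded (R : realType) (r la : R) (f : R -> R) :
  0 < r -> r < 1 -> la != 0 -> measurable_fun setT f ->
  (@lebesgue_measure R).-integrable `]0%R, 1%R[ (EFin \o f) ->
  {ae @lebesgue_measure R, forall x, `]0%R, 1%R[%classic x -> la * f x = Kop r f x} ->
  exists2 B, 0 <= B &
    {ae @lebesgue_measure R, forall x, `]0%R, 1%R[%classic x -> `|f x| <= B}.
Proof.
move=> r0 r1 la0 mf intf fE.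
set D := `]0%R, 1%R[%classic in intf fE *.
have mD : measurable D by exact: measurable_itv.
have aeF := ae_filter_ringOfSetsType (@lebesgue_measure R).
have nla0 : 0 < `|la| by rewrite normr_gt0.
have [d d0 md] : exists2 d, 0 < d & near_mass r d <= `|la| / 2.
  by apply: near_mass_small => //; rewrite divr_gt0.
pose psi : R -> R := (fun x => `|f x|) \_ D.
have psi0 x : 0 <= psi x by apply: restrict_ge0 => y _.
have mnf : measurable_fun setT (fun x => `|f x|).
  by apply: (measurableT_comp _ mf); exact: normr_measurable.
have mpsi : measurable_fun setT psi.
  by apply/(measurable_restrictT _ _).1 => //; apply: measurable_funTS.
have intpsi : (\int[@lebesgue_measure R]_x (psi x)%:E < +oo)%E.
  have /integrableP[_] := intf; rewrite integral_mkcond.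
  by apply: le_lt_trans; rewrite /psi restrict_EFin.
pose I := fine (\int[@lebesgue_measure R]_x (psi x)%:E)%E.
have IE : (\int[@lebesgue_measure R]_x (psi x)%:E = I%:E)%E.
  by rewrite fineK// ge0_fin_numE// integral_ge0// => x _; rewrite lee_fin.
have I0 : 0 <= I by rewrite -lee_fin -IE integral_ge0// => x _; rewrite lee_fin.
(* far kernel <= d^(-r), hence |K_far f| <= d^(-r) I = |la| B / 2, which leaves
   the other half of |la| B to the near part *)
pose B := 2 * d `^ (- r) * I / `|la|.
have B0 : 0 <= B by rewrite divr_ge0 ?mulr_ge0 ?powR_ge0.
pose w x := Num.max 0 (psi x - B).
have w0 x : 0 <= w x by rewrite le_max lexx.
have mw : measurable_fun setT w.
  by apply: measurable_maxr => //; apply: measurable_funB.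
have psi_le x : psi x <= B + w x.
  by rewrite /w -lerBlDl le_max lexx orbT.
have w_le x : w x <= psi x.
  by rewrite /w ge_max psi0/= lerBlDr lerDl.
(* pointwise subsolution inequality |la| w <= N w *)
have key : {ae @lebesgue_measure R, forall x, setT x ->
    ((`|la| * w x)%:E <= \int[@lebesgue_measure R]_y (near_kernel r d (x - y)%R * w y)%:E)%E}.
  move: fE; apply: filterS => x fxE _.
  have N0 : (0 <= \int[@lebesgue_measure R]_y (near_kernel r d (x - y)%R * w y)%:E)%E.
    by apply: integral_ge0 => y _; rewrite lee_fin mulr_ge0 ?near_kernel_ge0.
  have [psiB|Bpsi] := leP (psi x) B.
    suff -> : w x = 0 by rewrite mulr0.
    by apply/max_idPl; rewrite subr_le0.
  have Dx : D x.
    apply: contrapT => nDx; move: Bpsi; rewrite /psi patchE memNset//.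
    by rewrite ltNge B0.
  have wE : w x = psi x - B by apply/max_idPr; rewrite subr_ge0 ltW.
  have psiE : psi x = `|f x| by rewrite /psi patchE mem_set.
  suff : ((`|la| * psi x)%:E <= (`|la| * B)%:E +
      \int[@lebesgue_measure R]_y (near_kernel r d (x - y)%R * w y)%:E)%E.
    by rewrite wE mulrBr EFinB leeBlDl// addeC.
  rewrite psiE -normrM fxE// /Kop /Rintegral.
  have mkf : measurable_fun D (fun y => (`|x - y| `^ (- r) * f y)%:E).
    apply: measurable_funTS; apply/measurable_EFinP; apply: measurable_funM => //.
    exact: (measurable_subr x (measurable_norm_powR (- r))).
  apply: (@le_trans _ _ (\int[@lebesgue_measure R]_(y in D) `|(`|x - y|%R `^ (- r) * f y)%:E|)%E).
    have := le_abse_integral (@lebesgue_measure R) mD mkf.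
    move=> H; apply: (le_trans _ H).
    (* the integral may diverge, in which case its real part is 0 *)
    by case: (integral _ _ _) => [s| |]//=; rewrite normr0 ?leey.
  have -> : (\int[@lebesgue_measure R]_(y in D) `|(`|x - y|%R `^ (- r) * f y)%:E| =
     \int[@lebesgue_measure R]_y (`|x - y|%R `^ (- r) * psi y)%:E)%E.
    rewrite integral_mkcond; apply: eq_integral => y _.
    rewrite /psi !patchE; case: ifP => _; last by rewrite mulr0.
    by rewrite /= normrM (ger0_norm (powR_ge0 _ _)).
  have mk1 : measurable_fun setT (fun y => (d `^ (- r) * psi y)%:E).
    by apply/measurable_EFinP; apply: measurable_funM.
  have mk2 : measurable_fun setT (fun y : R => (B * near_kernel r d (x - y))%:E).
    apply/measurable_EFinP; apply: measurable_funM => //.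
    by apply: measurable_subr; exact: measurable_near_kernel.
  have mk3 : measurable_fun setT (fun y : R => (near_kernel r d (x - y) * w y)%:E).
    apply/measurable_EFinP; apply: measurable_funM => //.
    by apply: measurable_subr; exact: measurable_near_kernel.
  (* far <= d^(-r), and psi <= B + w against the near part *)
  apply: (@le_trans _ _ (\int[@lebesgue_measure R]_y
     ((d `^ (- r) * psi y)%:E + (B * near_kernel r d (x - y)%R)%:E +
      (near_kernel r d (x - y)%R * w y)%:E))%E).
    apply: ge0_le_integral => //.
    - by move=> y _; rewrite lee_fin mulr_ge0 ?powR_ge0.
    - apply/measurable_EFinP; apply: measurable_funM => //.
      exact: (measurable_subr x (measurable_norm_powR (- r))).
    - by apply: emeasurable_funD => //; exact: emeasurable_funD.
    move=> y _; rewrite -!EFinD lee_fin (@far_near_kernel _ _ d)//.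
    rewrite mulrDl -addrA lerD//.
      by rewrite ler_wpM2r// far_kernel_le.
    by rewrite (mulrC B) -mulrDr ler_wpM2l// near_kernel_ge0.
  rewrite ge0_integralD//; last 3 first.
  - by move=> y _; rewrite -EFinD lee_fin addr_ge0// mulr_ge0 ?powR_ge0 ?near_kernel_ge0.
  - exact: emeasurable_funD.
  - by move=> y _; rewrite lee_fin mulr_ge0 ?near_kernel_ge0.
  apply: leeD => //.
  rewrite ge0_integralD//; last 2 first.
  - by move=> y _; rewrite lee_fin mulr_ge0 ?powR_ge0.
  - by move=> y _; rewrite lee_fin mulr_ge0 ?near_kernel_ge0.
  under eq_integral => y _ do rewrite EFinM.
  rewrite ge0_integralZl//; last 3 first.
  - exact/measurable_EFinP.
  - by move=> y _; rewrite lee_fin.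
  - by rewrite lee_fin powR_ge0.
  under [X in (_ + X <= _)%E]eq_integral => y _ do rewrite EFinM.
  rewrite ge0_integralZl//; last 2 first.
  - by apply/measurable_EFinP; apply: measurable_subr; exact: measurable_near_kernel.
  - by move=> y _; rewrite lee_fin near_kernel_ge0.
  rewrite IE.
  apply: (@le_trans _ _ ((d `^ (- r))%:E * I%:E + B%:E * (near_mass r d)%:E)%E).
    by rewrite leeD2l// lee_wpmul2l ?lee_fin// integral_near_kernelr.
  rewrite -!EFinM -EFinD lee_fin.
  have dI : d `^ (- r) * I = `|la| / 2 * B by rewrite /B; field; rewrite gt_eqF.
  rewrite dI; have := ler_wpM2l B0 md; lra.
have Iw : (\int[@lebesgue_measure R]_x (w x)%:E <= I%:E)%E.
  rewrite -IE; apply: ge0_le_integral => //; try exact/measurable_EFinP.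
  - by move=> x _; rewrite lee_fin.
  - by move=> x _; rewrite lee_fin.
have [J JE] : exists J, (\int[@lebesgue_measure R]_x (w x)%:E = J%:E)%E.
  exists (fine (\int[@lebesgue_measure R]_x (w x)%:E)); rewrite fineK// ge0_fin_numE.
    exact: (le_lt_trans Iw (ltry _)).
  by apply: integral_ge0 => x _; rewrite lee_fin.
have J0 : 0 <= J by rewrite -lee_fin -JE integral_ge0// => x _; rewrite lee_fin.
(* integrate the subsolution inequality; J is finite because w <= psi *)
have : (`|la|%:E * J%:E <= (near_mass r d)%:E * J%:E)%E.
  rewrite -{1}JE -ge0_integralZl//; last 2 first.
  - exact/measurable_EFinP.
  - by move=> x _; rewrite lee_fin.
  have mk := measurable_near_smoothing r d mw.
  have k0 z : (0 <= ((near_kernel r d (z.1 - z.2) * w z.2)%R)%:E :> \bar R)%E.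
    by rewrite lee_fin mulr_ge0 ?near_kernel_ge0.
  apply: (@le_trans _ _ (\int[@lebesgue_measure R]_x \int[@lebesgue_measure R]_y
      (near_kernel r d (x - y)%R * w y)%:E)%E); last first.
    by rewrite -JE; exact: integral_near_smoothing.
  apply: ae_ge0_le_integral => //.
  - by move=> x _; rewrite lee_fin mulr_ge0.
  - by apply/measurable_EFinP; apply: measurable_funM.
  - by move=> x _; apply: integral_ge0 => y _; rewrite lee_fin mulr_ge0 ?near_kernel_ge0.
  - exact: (measurable_fun_fubini_tonelli_F (fun z : measurableTypeR R * measurableTypeR R =>
      (near_kernel r d (z.1 - z.2) * w z.2)%:E) mk k0).
rewrite -!EFinM lee_fin => laJ.
have J00 : J = 0.
  have := ler_wpM2r J0 md; nra.
exists B => //.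
have : ae_eq (@lebesgue_measure R) setT (EFin \o w) (cst 0%E).
  apply/ae_eq_integral_abs => //; first exact/measurable_EFinP.
  rewrite -[RHS]/(0%:E) -J00 -JE; apply: eq_integral => x _ /=.
  by rewrite ger0_norm.
apply: filterS => x /(_ Logic.I) -[wx0] Dx.
by have := psi_le x; rewrite wx0 addr0 /psi patchE mem_set.
Qed.

(** * The operator maps bounded functions to continuous functions *)

Lemma integrable01_cst (R : realType) (c : R) :
  (@lebesgue_measure R).-integrable `]0%R, 1%R[ (EFin \o cst c).
Proof.
apply/integrableP; split; first by apply/measurable_EFinP; exact: measurable_cst.
rewrite (eq_integral (cst (`|c|%:E)%E))// integral_cst//=.
by rewrite lebesgue_measure_itv/= lte_fin ltr01 -EFinB -EFinM ltry.
Qed.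

Lemma integrable_near_kernel (R : realType) (r d x : R) : 0 < r -> r < 1 -> 0 < d ->
  (@lebesgue_measure R).-integrable setT (EFin \o (fun y => near_kernel r d (x - y))).
Proof.
move=> r0 r1 d0; apply/integrableP; split.
  by apply/measurable_EFinP; apply: measurable_subr; exact: measurable_near_kernel.
apply: le_lt_trans (le_lt_trans (integral_near_kernelr x r0 r1 d0) (ltry _)).
rewrite le_eqVlt; apply/orP; left; apply/eqP; apply: eq_integral => y _ /=.
by rewrite ger0_norm// near_kernel_ge0.
Qed.

Section bounded_density.
Context (R : realType) (r : R) (f : R -> R) (B : R).
Hypotheses (r0 : 0 < r) (r1 : r < 1) (mf : measurable_fun setT f)
  (fB : forall y, `]0%R, 1%R[%classic y -> `|f y| <= B).
Local Notation mu := (@lebesgue_measure R).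
Local Notation D := `]0%R, 1%R[%classic.

Let mD : measurable (D : set R). Proof. exact: measurable_itv. Qed.

Let B0 : 0 <= B.
Proof.
apply: le_trans (fB (y := 2^-1) _); first exact: normr_ge0.
by rewrite /= in_itv/=; apply/andP; split; lra.
Qed.

Let integrable_near (d x : R) : 0 < d ->
  mu.-integrable D (EFin \o (fun y => near_kernel r d (x - y))).
Proof.
move=> d0.
apply: (@integrableS _ _ _ mu setT D _ measurableT mD (@subsetT _ _)).
exact: integrable_near_kernel.
Qed.

Let integrable_near_cst (d x : R) : 0 < d ->
  mu.-integrable D (EFin \o (fun y => B * near_kernel r d (x - y))).
Proof. by move=> d0; exact: (@integrableZl _ _ _ mu D mD B _ (integrable_near x d0)). Qed.

Lemma integrable_near_mul (d x : R) : 0 < d ->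
  mu.-integrable D (EFin \o (fun y => near_kernel r d (x - y) * f y)).
Proof.
move=> d0.
apply: (@le_integrable _ _ _ mu D mD _ _ _ _ (integrable_near_cst x d0)).
- apply/measurable_EFinP; apply: measurable_funTS; apply: measurable_funM => //.
  by apply: measurable_subr; exact: measurable_near_kernel.
- move=> y Dy /=; rewrite lee_fin normrM mulrC.
  rewrite [leRHS](ger0_norm (mulr_ge0 B0 (near_kernel_ge0 _ _ _))).
  by rewrite (ger0_norm (near_kernel_ge0 _ _ _)) ler_wpM2r ?near_kernel_ge0 ?fB.
Qed.

Lemma integrable_far_mul (d x : R) : 0 < d ->
  mu.-integrable D (EFin \o (fun y => far_kernel r d (x - y) * f y)).
Proof.
move=> d0.
apply: (@le_integrable _ _ _ mu D mD _ (EFin \o cst (d `^ (- r) * B))).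
- apply/measurable_EFinP; apply: measurable_funTS; apply: measurable_funM => //.
  by apply: measurable_subr; exact: measurable_far_kernel.
- move=> y Dy /=; rewrite lee_fin normrM [leRHS]ger0_norm ?mulr_ge0 ?powR_ge0//.
  apply: ler_pM; rewrite ?normr_ge0// ?fB//.
  by rewrite ger0_norm ?far_kernel_ge0// far_kernel_le.
- exact: integrable01_cst.
Qed.

Lemma integrable_kernel_mul (x : R) :
  mu.-integrable D (EFin \o (fun y => `|x - y| `^ (- r) * f y)).
Proof.
have -> : EFin \o (fun y => `|x - y| `^ (- r) * f y) =
    (EFin \o (fun y => far_kernel r 1 (x - y) * f y)) \+
    (EFin \o (fun y => near_kernel r 1 (x - y) * f y)) :> (R -> \bar R).
  by apply/funext => y /=; rewrite (@far_near_kernel _ _ 1)// mulrDl.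
by apply: integrableD => //; [exact: integrable_far_mul|exact: integrable_near_mul].
Qed.

Lemma Kop_sub_far (d x : R) : 0 < d ->
  `|Kop r f x - \int[mu]_(y in D) (far_kernel r d (x - y) * f y)| <=
  B * near_mass r d.
Proof.
move=> d0.
have -> : Kop r f x - \int[mu]_(y in D) (far_kernel r d (x - y) * f y) =
    \int[mu]_(y in D) (near_kernel r d (x - y) * f y).
  rewrite /Kop -RintegralB//; last 2 first.
  - exact: integrable_kernel_mul.
  - exact: integrable_far_mul.
  apply: eq_Rintegral => y _; rewrite (@far_near_kernel _ _ d)//.
  by rewrite mulrDl addrC addKr.
apply: (le_trans (@le_normr_Rintegral _ _ _ mu D _ mD (integrable_near_mul x d0))).
apply: (@le_trans _ _ (\int[mu]_(y in D) (B * near_kernel r d (x - y)))).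
  apply: le_Rintegral => //.
  - by apply: integrable_norm => //; exact: integrable_near_mul.
  - exact: integrable_near_cst.
  move=> y Dy; rewrite normrM mulrC (ger0_norm (near_kernel_ge0 _ _ _)).
  by rewrite ler_wpM2r ?near_kernel_ge0// fB.
rewrite RintegralZl//; last exact: integrable_near.
rewrite ler_wpM2l// -lee_fin /Rintegral fineK; last first.
  by apply: integrable_fin_num => //; exact: integrable_near.
apply: le_trans (integral_near_kernelr x r0 r1 d0).
apply: ge0_subset_integral => //.
- by apply/measurable_EFinP; apply: measurable_subr; exact: measurable_near_kernel.
- by move=> y _; rewrite lee_fin near_kernel_ge0.
Qed.

Lemma continuous_far_integral (d : R) : 0 < d ->
  continuous (fun x => \int[mu]_(y in D) (far_kernel r d (x - y) * f y)).
Proof.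
move=> d0 x.
have xI : x \in `]x - 1, x + 1[%classic.
  by rewrite inE/= in_itv/=; apply/andP; split; lra.
apply: (@continuity_under_integral R _ _ mu (fun x y => far_kernel r d (x - y) * f y)
  D mD (x - 1) (x + 1) _ _ (cst (d `^ (- r) * B)) _ _ x xI).
- by move=> z _; exact: integrable_far_mul.
- apply: aeW => y _ z _.
  apply: (@continuousM _ _ (fun z => far_kernel r d (z - y))); last exact: cst_continuous.
  apply: (@continuous_comp _ _ _ (fun z => z - y) (far_kernel r d)).
    by apply: continuousB; [exact: cvg_id | exact: cst_continuous].
  exact: continuous_far_kernel.
- exact: integrable01_cst.
- move=> z _; apply: aeW => y Dy; rewrite normrM.
  apply: ler_pM; rewrite ?normr_ge0// ?fB//.
  by rewrite ger0_norm ?far_kernel_ge0// far_kernel_le.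
Qed.

(** Uniform limit, as d tends to 0, of the continuous functions given by the
    far parts. *)
Lemma continuous_Kop : continuous (Kop r f).
Proof.
move=> x; apply/cvgrPdist_lt => e e0.
have B1 : 0 < B + 1 by rewrite ltr_wpDl.
have [d d0 md] : exists2 d, 0 < d & near_mass r d <= e / (4 * (B + 1)).
  by apply: near_mass_small => //; rewrite divr_gt0// mulr_gt0.
have Bm : B * near_mass r d <= e / 4.
  apply: (@le_trans _ _ ((B + 1) * (e / (4 * (B + 1))))).
    by rewrite ler_pM// ?near_mass_ge0// lerDl.
  by rewrite le_eqVlt; apply/orP; left; apply/eqP; field; rewrite gt_eqF.
have e4 : 0 < e / 4 by rewrite divr_gt0.
have /cvgrPdist_lt/(_ _ e4) := @continuous_far_integral d d0 x.
apply: filterS => y.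
have := Kop_sub_far x d0; have := Kop_sub_far y d0.
set Kx := Kop r f x; set Ky := Kop r f y.
set Fx := \int[_]_(_ in _) _; set Fy := \int[_]_(_ in _) _.
rewrite !ler_norml !ltr_norml => /andP[? ?] /andP[? ?] /andP[? ?].
by apply/andP; split; lra.
Qed.

End bounded_density.

Lemma eq_ae_Kop (R : realType) (r : R) (f g : R -> R) :
  measurable_fun setT f -> measurable_fun setT g ->
  {ae @lebesgue_measure R, forall x, `]0%R, 1%R[%classic x -> f x = g x} ->
  Kop r f = Kop r g.
Proof.
move=> mf mg fg; apply/funext => x; congr fine.
have mk (h : R -> R) : measurable_fun setT h ->
    measurable_fun (`]0%R, 1%R[%classic : set R) (fun y : R => (`|x - y| `^ (- r) * h y)%:E).
  move=> mh; apply: measurable_funTS; apply/measurable_EFinP; apply: measurable_funM => //.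
  exact: (measurable_subr x (measurable_norm_powR (- r))).
apply: ae_eq_integral; [exact: measurable_itv|exact: mk|exact: mk|].
have aeF := ae_filter_ringOfSetsType (@lebesgue_measure R).
by apply: filterS fg => y fgy Dy /=; rewrite fgy.
Qed.

(** The function F is K f / la.  It is defined on the whole line, and the
    equation la F = K F holds at every point of it; the values on (1, 1/s]
    enter the dilation identity below. *)
Lemma Kop_eigen_continuous (R : realType) (r la : R) (f : R -> R) :
  0 < r -> r < 1 -> la != 0 -> measurable_fun setT f ->
  (@lebesgue_measure R).-integrable `]0%R, 1%R[ (EFin \o f) ->
  {ae @lebesgue_measure R, forall x, `]0%R, 1%R[%classic x -> la * f x = Kop r f x} ->
  exists F : R -> R, [/\ continuous F, (forall x, la * F x = Kop r F x) &
    {ae @lebesgue_measure R, forall x, `]0%R, 1%R[%classic x -> f x = F x}].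
Proof.
move=> r0 r1 la0 mf intf fE.
have [B B0 fB] := Kop_eigen_ae_bounded r0 r1 la0 mf intf fE.
have aeF := ae_filter_ringOfSetsType (@lebesgue_measure R).
(* an everywhere bounded version of f *)
pose g x := Num.max (- B) (Num.min B (f x)).
have mg : measurable_fun setT g.
  by apply: measurable_maxr => //; exact: measurable_minr.
have gB x : `|g x| <= B.
  rewrite ler_norml /g le_max lexx/= ge_max; apply/andP; split; first lra.
  by rewrite ge_min lexx.
have fg : {ae @lebesgue_measure R, forall x, `]0%R, 1%R[%classic x -> f x = g x}.
  apply: filterS fB => x h /h; rewrite ler_norml => /andP[h1 h2].
  by rewrite /g (min_idPr h2) (max_idPr h1).
have cK : continuous (Kop r g) by apply: (@continuous_Kop _ r g B).
pose F x := la^-1 * Kop r g x.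
have cF : continuous F.
  by move=> x; apply: (@continuousM _ _ (cst la^-1) (Kop r g)); [exact: cst_continuous|exact: cK].
have mF : measurable_fun setT F by exact: continuous_measurable_fun.
have fF : {ae @lebesgue_measure R, forall x, `]0%R, 1%R[%classic x -> f x = F x}.
  apply: filterS fE => x h /h; rewrite /F (eq_ae_Kop r mf mg fg) => <-.
  by rewrite mulrA mulVf// mul1r.
exists F; split => // x.
by rewrite -(eq_ae_Kop r mf mF fF) (eq_ae_Kop r mf mg fg) /F mulrA mulfV// mul1r.
Qed.

(** * The dilation identity *)

(** By Fubini and |s x - y| = s |x - y / s|: up to the factor s^(-r), the
    adjoint of K followed by the dilation by s is K followed by the dilation by
    1 / s. *)
Lemma Kop_dilation_adjoint (R : realType) (r s B : R) (f : R -> R) :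
  0 < r -> r < 1 -> 0 < s -> measurable_fun setT f ->
  (forall y, `]0%R, 1%R[%classic y -> `|f y| <= B) ->
  \int[@lebesgue_measure R]_(x in `]0%R, 1%R[) (f x * Kop r f (s * x)) =
  s `^ (- r) * \int[@lebesgue_measure R]_(y in `]0%R, 1%R[) (f y * Kop r f (s^-1 * y)).
Proof.
move=> r0 r1 s0 mf fB; set D := `]0%R, 1%R[%classic.
pose mu := @lebesgue_measure R.
have mD : measurable (D : set R) by exact: measurable_itv.
have B0 : 0 <= B.
  apply: le_trans (fB (2^-1) _); first exact: normr_ge0.
  by rewrite /= in_itv/=; apply/andP; split; lra.
have muD : mu D = 1%E.
  by rewrite /mu /D lebesgue_measure_itv/= lte_fin ltr01 oppr0 adde0.
pose phi : R -> R := f \_ D.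
have mphi : measurable_fun setT phi.
  by apply/(measurable_restrictT _ _).1 => //; exact: measurable_funTS.
pose h (a : R) (z : measurableTypeR R * measurableTypeR R) : \bar R :=
  (`|a * z.1 - z.2| `^ (- r) * phi z.2 * phi z.1)%:E.
have mh a : measurable_fun setT (h a).
  apply/measurable_EFinP; apply: measurable_funM; last first.
    by apply: (measurableT_comp mphi); exact: measurable_fst.
  apply: measurable_funM; last first.
    by apply: (measurableT_comp mphi); exact: measurable_snd.
  apply: (measurableT_comp (measurable_norm_powR (- r))).
  apply: measurable_funB; last exact: measurable_snd.
  by apply: measurable_funM => //; exact: measurable_fst.
have inner c : (\int[mu]_y (`|c - y|%R `^ (- r) * phi y)%:E = (Kop r f c)%:E)%E.
  rewrite /Kop /Rintegral fineK; last first.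
    by apply: integrable_fin_num => //; exact: (integrable_kernel_mul (B := B)).
  rewrite [RHS]integral_mkcond; apply: eq_integral => y _.
  by rewrite /phi !patchE; case: ifP => // _; rewrite mulr0.
have inner_int c : mu.-integrable setT (EFin \o (fun y => `|c - y| `^ (- r) * phi y)).
  have H := integrable_kernel_mul r0 r1 mf fB c.
  have := (@integrable_mkcond _ _ _ mu D _ mD).1 H; apply: eq_integrable => // y _.
  by rewrite patchE /phi /= patchE; case: ifP => // _; rewrite mulr0.
(* absolute convergence: |f| <= B, and the kernel is at most 1 + its near part
   of width 1 *)
have inth a : (mu \x mu)%E.-integrable setT (h a).
  apply/integrable12ltyP => //.
  have mah : measurable_fun setT (abse \o h a) by exact: measurableT_comp (mh a).
  pose C := B * (B * (1 + near_mass r 1)).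
  have C0 : 0 <= C by rewrite !mulr_ge0// addr_ge0// near_mass_ge0.
  apply: (@le_lt_trans _ _ (\int[mu]_x (C * \1_D x)%:E)%E); last first.
    under eq_integral => x _ do rewrite EFinM.
    rewrite ge0_integralZl//; last by apply/measurable_EFinP; exact: measurable_indic.
    by rewrite integral_indic// setIT [X in (_ * X)%E]muD mule1 ltry.
  apply: ge0_le_integral => //.
  - by move=> x _; apply: integral_ge0 => y _.
  - exact: (measurable_fun_fubini_tonelli_F (abse \o h a) mah (fun z => abse_ge0 (h a z))).
  - apply/measurable_EFinP; apply: measurable_funM => //; exact: measurable_indic.
  move=> x _.
  have phiB y : `|phi y| <= B * \1_D y.
    rewrite /phi patchE indicE; case: ifPn => [/set_mem/fB|_]; rewrite ?mulr1//.
    by rewrite normr0 mulr0.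
  apply: (@le_trans _ _ (\int[mu]_y
      ((B * \1_D x) * B * (\1_D y + near_kernel r 1 (a * x - y)%R))%:E)%E).
    apply: ge0_le_integral => //.
    - rewrite /h /=; apply/measurable_EFinP; apply: measurableT_comp; first exact: normr_measurable.
      apply: measurable_funM => //; apply: measurable_funM => //.
      exact: (measurable_subr (a * x) (measurable_norm_powR (- r))).
    - apply/measurable_EFinP; apply: measurable_funM => //; apply: measurable_funD => //.
      by apply: measurable_subr; exact: measurable_near_kernel.
    move=> y _; rewrite /h/= lee_fin !normrM (ger0_norm (powR_ge0 _ _)) mulrC -!mulrA.
    rewrite (mulrA B (\1_D x : R)) ler_pM ?mulr_ge0 ?powR_ge0//.
    rewrite (@far_near_kernel _ _ 1)//.
    have h1 := far_kernel_le (a * x - y) r0 r1 (@ltr01 R).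
    rewrite powR1 in h1.
    have h2 := far_kernel_ge0 r (a * x - y) (@ltr01 R).
    have h3 := near_kernel_ge0 r 1 (a * x - y).
    have := phiB y; rewrite indicE; case: (y \in D) => /=.
    + rewrite mulr1 => h4; rewrite mulrC ler_pM// ?addr_ge0//; lra.
    + rewrite mulr0 => h4; have -> : `|phi y| = 0 by apply/eqP; rewrite eq_le h4 normr_ge0.
      by rewrite mulr0 add0r mulr_ge0.
  have -> : C * \1_D x = (B * \1_D x) * B * (1 + near_mass r 1) by rewrite /C; ring.
  have BB : 0 <= B * \1_D x * B by rewrite !mulr_ge0.
  under eq_integral => y _ do rewrite EFinM.
  rewrite ge0_integralZl//; last 2 first.
  - apply/measurable_EFinP; apply: measurable_funD => //.
    by apply: measurable_subr; exact: measurable_near_kernel.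
  - by move=> y _; rewrite lee_fin addr_ge0// near_kernel_ge0.
  rewrite [leRHS]EFinM lee_wpmul2l ?lee_fin//.
  under eq_integral => y _ do rewrite EFinD.
  rewrite ge0_integralD//; last 3 first.
  - by apply/measurable_EFinP; exact: measurable_indic.
  - by move=> y _; rewrite lee_fin near_kernel_ge0.
  - by apply/measurable_EFinP; apply: measurable_subr; exact: measurable_near_kernel.
  rewrite EFinD leeD ?integral_near_kernelr//.
  by rewrite integral_indic// setIT [leLHS]muD.
have restr (g : R -> R) : \int[mu]_(x in D) (f x * g x) = fine (\int[mu]_x (g x * phi x)%:E).
  rewrite Rintegral_mkcond; congr fine; apply: eq_integral => x _.
  by rewrite /phi !patchE mulrC; case: ifP => // _; rewrite mulr0.
have FE a : fubini_F mu (h a) = (fun x => (Kop r f (a * x) * phi x)%:E).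
  apply/funext => x; rewrite /fubini_F /h/=.
  under eq_integral => y _ do rewrite EFinM.
  by rewrite integralZr//= ?inner//; exact: inner_int.
have GE : fubini_G mu (h s) = (fun y => (s `^ (- r) * (Kop r f (s^-1 * y) * phi y))%:E).
  apply/funext => y; rewrite /fubini_G /h/=.
  (* homogeneity of the kernel *)
  have hE u : `|s * u - y| `^ (- r) * phi y * phi u =
      (s `^ (- r) * phi y) * (`|s^-1 * y - u| `^ (- r) * phi u).
    have -> : s * u - y = s * - (s^-1 * y - u) by field; rewrite gt_eqF.
    by rewrite normrM normrN (gtr0_norm s0) powRM ?(ltW s0)//; ring.
  under eq_integral => u _ do rewrite hE EFinM.
  rewrite integralZl//=; last exact: inner_int.
  by rewrite inner -EFinM; congr EFin; ring.
have intg : mu.-integrable setT (fun y => (Kop r f (s^-1 * y) * phi y)%:E).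
  by rewrite -FE; exact: integrable_fubini_F (inth s^-1).
have swap : (\int[mu]_x (Kop r f (s * x)%R * phi x)%:E =
    \int[mu]_y (s `^ (- r) * (Kop r f (s^-1 * y)%R * phi y))%:E)%E.
  transitivity (\int[mu]_x fubini_F mu (h s) x)%E; first by rewrite FE.
  transitivity (\int[mu]_y fubini_G mu (h s) y)%E; last by rewrite GE.
  exact: (Fubini (inth s)).
apply: (etrans (restr (fun x => Kop r f (s * x)))); rewrite swap.
under eq_integral => y _ do rewrite EFinM.
rewrite integralZl// fineM//; last exact: integrable_fin_num.
by congr (_ * _); apply/esym; exact: (restr (fun y => Kop r f (s^-1 * y))).
Qed.

Lemma continuous_integrable_cc (R : realType) (G : R -> R) (a b : R) :
  continuous G -> (@lebesgue_measure R).-integrable `[a, b] (EFin \o G).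
Proof.
move=> cG; apply: continuous_compact_integrable; first exact: segment_compact.
exact: continuous_subspaceT.
Qed.

Lemma Rintegral_dilation (R : realType) (G : R -> R) (s : R) :
  0 < s -> continuous G ->
  \int[@lebesgue_measure R]_(y in `[0, 1]) G y =
  s * \int[@lebesgue_measure R]_(z in `[0, s^-1]) G (s * z).
Proof.
move=> s0 cG.
have isd (z : R) : is_derive z (1 : R) (fun z => s * z) s.
  have := is_deriveM (is_derive_cst s z 1) (is_derive_id z 1).
  by move=> /is_derive_eq; apply; rewrite scaler0 addr0 /GRing.scale/= mulr1.
have dE : (fun z : R => s * z)^`()%classic = cst s.
  by apply/funext => z; rewrite derive1E; have [_ ->] := isd z.
have cs : continuous (fun z : R => s * z) by exact: mulrl_continuous.
have := @integration_by_substitution_increasing R (fun z => s * z) G 0 s^-1.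
rewrite mulr0 mulfV ?gt_eqF// dE => H.
rewrite /Rintegral H.
- rewrite -[RHS]RintegralZl//; last first.
    apply: continuous_integrable_cc => z.
    by apply: (continuous_comp (cs z)); exact: cG.
  by congr fine; apply: eq_integral => z _; rewrite /= mulrC.
- by rewrite invr_ge0 ltW.
- by move=> x y _ _ xy; rewrite ltr_pM2l.
- by move=> x _; exact: cst_continuous.
- exact: is_cvg_cst.
- exact: is_cvg_cst.
- split.
  + by move=> z _; have [] := isd z.
  + exact/cvg_at_right_filter/cs.
  + exact/cvg_at_left_filter/cs.
- exact: continuous_subspaceT.
Qed.

(** Young's inequality: the concave function s^(1-r) lies below its tangent
    at 1. *)
Lemma powR_le_tangent1 (R : realType) (r s : R) : 0 < r -> r < 1 -> 0 < s ->
  s `^ (1 - r) <= 1 - (1 - r) * (1 - s).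
Proof.
move=> r0 r1 s0.
have a0 : 0 < 1 - r by rewrite subr_gt0.
have := @conjugate_powR R (s `^ (1 - r)) 1 (1 - r)^-1 r^-1.
rewrite !invrK mulr1 powR1 -powRrM mulfV ?gt_eqF// powRr1 ?(ltW s0)// mul1r.
move=> H; apply: le_trans (H _ _ _ _ _) _; rewrite ?powR_ge0 ?invr_gt0//; lra.
Qed.

(** * A continuous eigenfunction vanishing at 1 is zero *)

Section vanishing.
Context (R : realType) (r la : R) (F : R -> R).
Hypotheses (r0 : 0 < r) (r1 : r < 1) (la0 : la != 0) (cF : continuous F)
  (FE : forall x, la * F x = Kop r F x).
Local Notation mu := (@lebesgue_measure R).

Let cFs (s : R) : continuous (fun z => F (s * z)).
Proof. by move=> z; apply: (continuous_comp (@mulrl_continuous R s z)); exact: cF. Qed.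

Let cG (s : R) : continuous (fun z => F (s * z) * F z).
Proof. by move=> z; apply: (continuousM (@cFs s z)); exact: cF. Qed.

(** Replace K F by la F in [Kop_dilation_adjoint], cancel la, substitute
    y = s z on the right, and split [0, 1/s] at 1. *)
Lemma eigen_dilation_identity (s : R) : 0 < s -> s <= 1 ->
  (1 - s `^ (1 - r)) * \int[mu]_(z in `[0, 1]) (F (s * z) * F z) =
  s `^ (1 - r) * \int[mu]_(z in `]1, s^-1]) (F (s * z) * F z).
Proof.
move=> s0 s1.
have cnF : continuous (fun x => `|F x|).
  by move=> x; apply: (continuous_comp (@cF x)); exact: norm_continuous.
have [c _ FM] := EVT_max (@ler01 R) (continuous_subspaceT cnF).
have FB y : `]0%R, 1%R[%classic y -> `|F y| <= `|F c|.
  by move=> /= /subset_itv_oo_cc; exact: FM.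
have mF : measurable_fun setT F by exact: continuous_measurable_fun.
have KF (a : R) : \int[mu]_(x in `]0, 1[) (F x * Kop r F (a * x)) =
    \int[mu]_(x in `]0, 1[) (la * (F x * F (a * x))).
  by apply: eq_Rintegral => x _; rewrite -FE mulrCA.
have KFs := Kop_dilation_adjoint r0 r1 s0 mF FB.
have := etrans (etrans (esym (KF s)) KFs) (congr1 ( *%R (s `^ (- r))) (KF s^-1)).
have cc (G : R -> R) : continuous G ->
    \int[mu]_(x in `]0, 1[) G x = \int[mu]_(x in `[0, 1]) G x.
  move=> cG'; rewrite /Rintegral -(@integral_itv_bndoo _ _ _ _ true false)//.
  by apply/measurable_EFinP; apply: measurable_funTS; exact: continuous_measurable_fun.
have cH1 : continuous (fun x => F x * F (s * x)).
  by move=> z; apply: (continuousM (@cF z)); exact: cFs.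
have cH2 : continuous (fun x => F x * F (s^-1 * x)).
  by move=> z; apply: (continuousM (@cF z)); exact: cFs.
have cla (G : R -> R) : continuous G -> continuous (fun x => la * G x).
  by move=> cG' z; apply: (@continuousM _ _ (cst la) G); [exact: cst_continuous|exact: cG'].
rewrite !cc; [|exact: cla|exact: cla].
rewrite !RintegralZl//; [|exact: continuous_integrable_cc|exact: continuous_integrable_cc].
rewrite mulrCA => /(mulfI la0).
rewrite [in RHS](Rintegral_dilation s0 cH2).
under [X in _ = _ * (_ * X)]eq_Rintegral => z _.
  rewrite mulKf ?gt_eqF//.
  over.
under eq_Rintegral => z _ do rewrite mulrC.
rewrite mulrA => E.
have sE : s `^ (- r) * s = s `^ (1 - r).
  by rewrite powRD ?powRr1 ?(ltW s0) 1?mulrC//; apply/implyP => _; rewrite gt_eqF.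
rewrite sE in E.
have i1 : 1 <= s^-1 by rewrite invf_ge1.
have := @Rintegral_itvB R (fun z => F (s * z) * F z) (BLeft 0) (BRight s^-1) 1
  (continuous_integrable_cc _ _ (@cG s)).
rewrite !bnd_simp => /(_ ler01 i1) <-.
rewrite mulrBr -E mulrBl mul1r; congr (_ - _).
Qed.

Lemma continuous_dilation_product :
  {for (1 : R), continuous (fun s : R => \int[mu]_(z in `[0, 1]) (F (s * z) * F z))}.
Proof.
have cnF : continuous (fun x => `|F x|).
  by move=> x; apply: (continuous_comp (@cF x)); exact: norm_continuous.
have [c _ FM] := EVT_max (ler0n R 2) (continuous_subspaceT cnF).
have FB y : 0 <= y -> y <= 2 -> `|F y| <= `|F c|.
  by move=> y0 y2; apply: FM; rewrite in_itv/= y0 y2.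
have xI : (1 : R) \in `]0, 2[%classic.
  by rewrite inE/= in_itv/=; apply/andP; split; lra.
apply: (@continuity_under_integral R _ _ mu (fun s z => F (s * z) * F z)
  `[0, 1]%classic (measurable_itv _) 0 2 _ _ (cst (`|F c| * `|F c|)) _ _ 1 xI).
- by move=> s _; exact: continuous_integrable_cc.
- apply: aeW => z _ s _.
  apply: (@continuousM _ _ (fun s : R => F (s * z)) (fun=> F z)); last exact: cst_continuous.
  apply: (@continuous_comp _ _ _ (fun s : R => s * z) F); last exact: cF.
  by apply: (@continuousM _ _ id (fun=> z : R)); [exact: cvg_id|exact: cst_continuous].
- by apply: continuous_integrable_cc; exact: cst_continuous.
- move=> s; rewrite /= in_itv/= => /andP[s0 s2]; apply: aeW => z.
  rewrite /= in_itv/= => /andP[z0 z1]; rewrite normrM ler_pM ?normr_ge0//.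
  + by apply: FB; [rewrite mulr_ge0// ltW|rewrite -[leRHS]mulr1 ler_pM// ltW].
  + by apply: FB => //; lra.
Qed.

(** Let s tend to 1 in [eigen_dilation_identity].  Near 1 the function F is at
    most q in absolute value, so the right-hand side is at most
    s^(1-r) q^2 (1/s - 1) <= 2 q^2 (1 - s), while on the left
    1 - s^(1-r) >= (1 - r) (1 - s); the factor 1 - s cancels. *)
Lemma Kop_eigen_eq0_at1_integral_sqr : F 1 = 0 ->
  \int[mu]_(z in `[0, 1]) (F z * F z) <= 0.
Proof.
move=> F1; apply/ler_addgt0Pr => e e0; rewrite add0r.
pose psi s := \int[mu]_(z in `[0, 1]) (F (s * z) * F z).
have -> : \int[mu]_(z in `[0, 1]) (F z * F z) = psi 1.
  by apply: eq_Rintegral => z _; rewrite mul1r.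
have a0 : 0 < 1 - r by rewrite subr_gt0.
(* chosen such that 2 q^2 / (1 - r) = e / 2 *)
pose q := Num.sqrt (e * (1 - r) / 4).
have q2 : q * q = e * (1 - r) / 4.
  by rewrite -expr2 sqr_sqrtr// divr_ge0// mulr_ge0 ?ltW.
have q0 : 0 < q by rewrite sqrtr_gt0 divr_gt0// mulr_gt0.
have [n /= n0 Fn] : exists2 n, 0 < n & forall z, `|1 - z| < n -> `|F z| <= q.
  have /cvgrPdist_lt/(_ _ q0) := @cF 1.
  move=> /nbhs_ballP[n /= n0 nP]; exists n => // z /nP.
  by rewrite F1 sub0r normrN => /ltW.
have e2 : 0 < e / 2 by rewrite divr_gt0.
have [s [s1 s2 sn sn' sE]] : exists s, [/\ s < 1, 2^-1 <= s,
    1 - s < n, s^-1 - 1 < n & `|psi 1 - psi s| < e / 2].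
  have /cvgrPdist_lt/(_ _ e2) := continuous_dilation_product.
  move=> /nbhs_ballP[m /= m0 mP].
  pose k := Num.min (Num.min (2^-1) (n / 4)) (m / 2).
  have k0 : 0 < k by rewrite !lt_min !divr_gt0// invr_gt0 ltr0n.
  have [k2 kn km] : [/\ k <= 2^-1, k <= n / 4 & k <= m / 2].
    by rewrite /k !ge_min !lexx ?orbT.
  exists (1 - k); split; try lra.
  - have h : 0 < 1 - k by lra.
    rewrite ltrBlDr -div1r ltr_pdivrMr//; nra.
  - by apply: mP; rewrite /ball/= opprB addrCA subrr addr0 gtr0_norm//; lra.
have s0 : 0 < s by lra.
suff : psi s <= e / 2.
  by move: sE; rewrite ltr_norml => /andP[? ?] ?; lra.
have B : `|\int[mu]_(z in `]1, s^-1]) (F (s * z) * F z)| <= q * q * (s^-1 - 1).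
  have i1 : 1 < s^-1 by rewrite invf_gt1.
  have mI : measurable (`]1, s^-1]%classic : set R) by exact: measurable_itv.
  have int1 (G : R -> R) : continuous G -> mu.-integrable `]1, s^-1] (EFin \o G).
    move=> cG'; apply: (@integrableS _ _ _ mu `[1, s^-1]%classic); rewrite //=.
      by apply: subset_itvr; rewrite bnd_simp.
    exact: continuous_integrable_cc.
  apply: (le_trans (@le_normr_Rintegral _ _ _ mu _ _ mI (int1 _ (@cG s)))).
  apply: (@le_trans _ _ (\int[mu]_(z in `]1, s^-1]) (q * q))).
    apply: le_Rintegral => //.
    - by apply: integrable_norm; exact: int1.
    - by apply: (int1 (cst (q * q))); exact: cst_continuous.
    move=> z; rewrite /= in_itv/= => /andP[z1 zs].
    have sz1 : s * z <= 1 by rewrite mulrC -ler_pdivlMr// div1r.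
    have ssz : s < s * z by rewrite -[ltLHS]mulr1 ltr_pM2l.
    rewrite normrM ler_pM ?normr_ge0//; apply: Fn; rewrite ltr_norml; lra.
  by rewrite Rintegral_cst//= lebesgue_measure_itv/= lte_fin i1.
have := eigen_dilation_identity s0 (ltW s1).
rewrite -/(psi s).
set I := \int[mu]_(z in `]1, s^-1]) _ in B *; move=> E.
have T := powR_le_tangent1 r0 r1 s0.
have [psi0|psi0] := leP (psi s) 0; first lra.
have P0 : 0 < s `^ (1 - r) by rewrite powR_gt0.
have Ps : s `^ (1 - r) * s^-1 <= 2.
  have -> : s `^ (1 - r) = s * s `^ (- r).
    by rewrite powRD ?powRr1 ?(ltW s0)//; apply/implyP => _; rewrite gt_eqF.
  rewrite mulrAC mulfV ?gt_eqF// mul1r powRN.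
  apply: (@le_trans _ _ s^-1); last by rewrite invf_ple ?posrE.
  rewrite lef_pV2 ?posrE ?powR_gt0// ger1_powR//; lra.
have I_le : I <= q * q * (s^-1 - 1) by apply: le_trans B; exact: ler_norm.
have h1 : (1 - r) * (1 - s) * psi s <= (1 - s `^ (1 - r)) * psi s.
  by rewrite ler_pM2r//; lra.
have h2 : s `^ (1 - r) * I <= s `^ (1 - r) * (q * q * (s^-1 - 1)).
  by rewrite ler_pM2l.
have h3 : s `^ (1 - r) * (q * q * (s^-1 - 1)) = q * q * (1 - s) * (s `^ (1 - r) * s^-1).
  by field; rewrite gt_eqF.
have h4 : q * q * (1 - s) * (s `^ (1 - r) * s^-1) <= q * q * (1 - s) * 2.
  by rewrite ler_wpM2l// !mulr_ge0 ?(ltW q0)//; lra.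
have h5 : (1 - r) * (1 - s) * psi s <= (1 - r) * (1 - s) * (e / 2).
  by apply: (le_trans h1); rewrite E; apply: (le_trans h2); rewrite h3;
    apply: (le_trans h4); rewrite q2; lra.
by move: h5; rewrite ler_pM2l// mulr_gt0//; lra.
Qed.

Lemma Kop_eigen_eq0_at1_ae_eq0 : F 1 = 0 ->
  {ae mu, forall x, `]0%R, 1%R[%classic x -> F x = 0}.
Proof.
move=> F1.
have cF2 : continuous (fun x => F x * F x).
  by move=> z; apply: (continuousM (@cF z)); exact: cF.
have mI : measurable (`[0, 1]%classic : set R) by exact: measurable_itv.
have I0 : (\int[mu]_(z in `[0%R, 1%R]) (F z * F z)%:E = 0)%E.
  have := Kop_eigen_eq0_at1_integral_sqr F1.
  rewrite /Rintegral -lee_fin fineK; last first.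
    exact: integrable_fin_num (continuous_integrable_cc _ _ cF2).
  move=> h; apply/eqP; rewrite eq_le h/=; apply: integral_ge0 => z _.
  by rewrite lee_fin -expr2 sqr_ge0.
have aeF := ae_filter_ringOfSetsType mu.
have : ae_eq mu `[0, 1]%classic (fun z => (F z * F z)%:E) (cst 0%E).
  apply/ae_eq_integral_abs => //.
    by apply/measurable_EFinP; apply: measurable_funTS; exact: continuous_measurable_fun.
  rewrite -[RHS]I0; apply: eq_integral => z _ /=.
  by rewrite ger0_norm// -expr2 sqr_ge0.
apply: filterS => x h /subset_itv_oo_cc/h [] /eqP.
by rewrite mulf_eq0 orbb => /eqP.
Qed.

End vanishing.

(** * From L^2 classes to functions, and conclusion *)

Lemma ae_lebesgue01 (R : realType) (P : R -> Prop) :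
  {ae lebesgue01 R, forall x, P x} <->
  {ae @lebesgue_measure R, forall x, `]0%R, 1%R[%classic x -> P x}.
Proof.
have mD : measurable (`]0%R, 1%R[%classic : set R) by exact: measurable_itv.
split=> -[A [mA A0 PA]].
- exists (A `&` `]0%R, 1%R[%classic); split; [exact: measurableI|exact: A0|].
  by move=> x /= /not_implyP[Dx nP]; split => //; exact: PA.
- exists (A `|` ~` `]0%R, 1%R[%classic); split.
  + by apply: measurableU => //; exact: measurableC.
  + apply/eqP; rewrite eq_le measure_ge0 andbT -A0.
    rewrite /lebesgue01/= /mrestr setIUl setICl setU0 le_measure ?inE//.
    exact: measurableI.
  + move=> x nP; have [Dx|nDx] := pselect (`]0%R, 1%R[%classic x); [left|by right].
    by apply: PA => /= /(_ Dx).
Qed.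

Lemma L2_01_measurable (R : realType) (f : L2_01 R) : measurable_fun setT (f : R -> R).
Proof. exact: (measurable_funP (repr (LebesgueSpace.sort f)) (D := setT)). Qed.

(** The measure of (0,1) is finite, so L^2 is contained in L^1. *)
Lemma L2_01_integrable (R : realType) (f : L2_01 R) :
  (@lebesgue_measure R).-integrable `]0%R, 1%R[ (EFin \o (f : R -> R)).
Proof.
have mD : measurable (`]0%R, 1%R[%classic : set R) by exact: measurable_itv.
have l01 : lebesgue01 R setT = 1%E.
  by rewrite /lebesgue01/= /mrestr setTI lebesgue_measure_itv/= lte_fin ltr01 oppr0 adde0.
have fin1 : lebesgue01 R setT \is a fin_num by rewrite l01.
have f2 : (f : R -> R) \in Lfun (lebesgue01 R) 2%:E.
  by rewrite inE; apply/andP; split; rewrite inE/=;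
    [exact: L2_01_measurable|exact: Lebesgue_finite].
have := Lfun_subset12 fin1 f2.
move=> /Lfun1_integrable/integrableP[mf]; move=> foo.
apply/integrableP; split; first exact: measurable_funTS.
apply: le_lt_trans foo.
have -> : (\int[@lebesgue_measure R]_(x in `]0%R, 1%R[) `|(EFin \o (f : R -> R)) x| =
   \int[lebesgue01 R]_(x in `]0%R, 1%R[) `|(EFin \o (f : R -> R)) x|)%E.
  apply: eq_measure_integral => A mA /setIidPl AD.
  by rewrite /lebesgue01/= /mrestr AD.
by apply: ge0_subset_integral => //; exact: measurableT_comp.
Qed.

Lemma Kop_linear (R : realType) (r a b : R) (F G : R -> R) (x : R) :
  0 < r -> r < 1 -> continuous F -> continuous G ->
  Kop r (fun y => a * F y + b * G y) x = a * Kop r F x + b * Kop r G x.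
Proof.
move=> r0 r1 cF cG.
have mD : measurable (`]0%R, 1%R[%classic : set R) by exact: measurable_itv.
have intK (H : R -> R) : continuous H ->
    (@lebesgue_measure R).-integrable `]0%R, 1%R[ (EFin \o (fun y => `|x - y| `^ (- r) * H y)).
  move=> cH.
  have cnH : continuous (fun x => `|H x|).
    by move=> z; apply: (continuous_comp (@cH z)); exact: norm_continuous.
  have [c _ HM] := EVT_max (@ler01 R) (continuous_subspaceT cnH).
  apply: (@integrable_kernel_mul R r H `|H c|) => //.
    exact: continuous_measurable_fun.
  by move=> y /subset_itv_oo_cc; exact: HM.
rewrite /Kop -!RintegralZl//; [|exact: intK|exact: intK].
rewrite -RintegralD//; last 2 first.
- exact: (@integrableZl _ _ _ (@lebesgue_measure R) _ mD a _ (intK _ cF)).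
- exact: (@integrableZl _ _ _ (@lebesgue_measure R) _ mD b _ (intK _ cG)).
by apply: eq_Rintegral => y _; ring.
Qed.

Unset Implicit Arguments.

Theorem proposition2p1 (R : realType) (rho : R) (rho_gt0 : 0 < rho)
    (rho_lt1 : rho < 1) (lambda : R) (lambda_neq0 : lambda <> 0)
    (lambda_eig : Kop_eigenvalue rho lambda) :
  Kop_simple rho lambda /\
  (forall f : L2_01 R, Kop_eigenfunction rho lambda f -> continuous_on01 f).
Proof.
have la0 : lambda != 0 by apply/eqP.
have aeF := ae_filter_ringOfSetsType (@lebesgue_measure R).
have reg (f : L2_01 R) : ker_sub_Kop rho lambda f ->
    exists F : R -> R, [/\ continuous F, (forall x, lambda * F x = Kop rho F x) &
    {ae @lebesgue_measure R, forall x, `]0%R, 1%R[%classic x -> f x = F x}].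
  move=> fker; apply: Kop_eigen_continuous => //.
  - exact: L2_01_measurable.
  - exact: L2_01_integrable.
  move/ae_lebesgue01 : fker; apply: filterS => x h /h/(_ Logic.I)/eqP.
  by rewrite subr_eq0 => /eqP.
split; last first.
  move=> f [/reg[F [cF _ fF]] _]; exists F; split.
    exact: continuous_subspaceT.
  apply/ae_lebesgue01; move: fF; apply: filterS => x h /h; exact.
have [e [eker enz]] := lambda_eig.
have [E [cE EE eE]] := reg e eker.
have E1 : E 1 != 0.
  apply/eqP => E1; apply: enz; apply/ae_lebesgue01.
  have := Kop_eigen_eq0_at1_ae_eq0 rho_gt0 rho_lt1 la0 cE EE E1.
  by move: eE; apply: filterS2 => x h1 h2 Dx _; rewrite h1// h2.
exists (fun=> e); split.
  move=> c ce0 i; rewrite (ord1 i); apply: contrapT => /eqP c0; apply: enz.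
  apply/ae_lebesgue01; move/ae_lebesgue01 : ce0; apply: filterS => x h Dx _.
  by have /eqP := h Dx Logic.I; rewrite big_ord1 mulf_eq0 (negbTE c0) => /eqP.
move=> f; split.
- move=> /reg[F [cF FE fF]].
  (* the combination F - (F(1) / E(1)) E vanishes at 1 *)
  exists (fun=> F 1 / E 1).
  pose c := - (F 1 / E 1).
  have cH : continuous (fun y => 1 * F y + c * E y).
    move=> z; apply: (@continuousD _ _ _ (fun y => 1 * F y) (fun y => c * E y)).
      by apply: (@continuousM _ _ (cst 1) F); [exact: cst_continuous|exact: cF].
    by apply: (@continuousM _ _ (cst c) E); [exact: cst_continuous|exact: cE].
  have HE x : lambda * (1 * F x + c * E x) = Kop rho (fun y => 1 * F y + c * E y) x.
    by rewrite Kop_linear// -FE -EE; ring.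
  have H1 : 1 * F 1 + c * E 1 = 0 by rewrite /c; field.
  have H0 := Kop_eigen_eq0_at1_ae_eq0 rho_gt0 rho_lt1 la0 cH HE H1.
  apply/ae_lebesgue01; move: fF eE H0; apply: filterS3 => x h1 h2 h3 Dx _.
  rewrite big_ord1 h1// h2//; apply/eqP; rewrite -subr_eq0; apply/eqP.
  by rewrite -[RHS](h3 Dx) /c; ring.
- move=> [c fce].
  have mf := L2_01_measurable f.
  have cH : continuous (fun y => c ord0 * E y + 0 * E y).
    move=> z; apply: (@continuousD _ _ _ (fun y => c ord0 * E y) (fun y => 0 * E y)).
      by apply: (@continuousM _ _ (cst (c ord0)) E); [exact: cst_continuous|exact: cE].
    by apply: (@continuousM _ _ (cst 0) E); [exact: cst_continuous|exact: cE].
  have fH : {ae @lebesgue_measure R, forall x, `]0%R, 1%R[%classic x ->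
      f x = c ord0 * E x + 0 * E x}.
    move/ae_lebesgue01 : fce; move: eE; apply: filterS2 => x h1 h2 Dx.
    by rewrite h2// big_ord1 h1//; ring.
  have KE : Kop rho f = Kop rho (fun y => c ord0 * E y + 0 * E y).
    by apply: eq_ae_Kop => //; exact: continuous_measurable_fun.
  rewrite /ker_sub_Kop/=; apply/ae_lebesgue01.
  move: fH; apply: filterS => x h Dx _.
  by rewrite h// KE Kop_linear// -EE; ring.
Qed.
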